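(* Let $f$ be differentiable, not necessarily convex, on $\mathcal{X}=\mathcal{X}_1\times\cdots\times\mathcal{X}_{N_b}$, let $\alpha=B/N_b$, and let $\gamma_t=\dfrac{2}{\alpha t+2}$ for $t\ge 0$. Then the iterates $\{\mathbf{x}^t\}$ of the randomized block Frank-Wolfe algorithm with step sizes $\{\gamma_t\}$ satisfy $$g_t=\mathcal{O}\!\left(\frac{1}{\log t}\right)\qquad\text{as } t\to\infty,$$ where $g_t:=\min_{k\in\{0,1,\ldots,t\}}\mathbb{E}[g(\mathbf{x}^k)]$.
   Context: Setting. $N_b\ge 1$ is an integer, $\mathcal{N}_b=\{1,\ldots,N_b\}$, $B\in\{1,\ldots,N_b\}$, $\alpha:=B/N_b$. Vectors $\mathbf{x}\in\mathbb{R}^d$ are split into blocks $\mathbf{x}=(\mathbf{x}_1,\ldots,\mathbf{x}_{N_b})$. The feasible set is $\mathcal{X}=\mathcal{X}_1\times\cdots\times\mathcal{X}_{N_b}$, with each $\mathcal{X}_n$ nonempty, convex and compact. The objective $f$ is real-valued and differentiable on (an open set containing) $\mathcal{X}$; $\nabla_{\mathbf{x}_n}f$ denotes the partial gradient with respect to block $n$. The duality gap (a measure of non-stationarity; $g(\mathbf{x})=0$ iff $\mathbf{x}$ is a stationary point of the problem of minimizing $f$ over $\mathcal{X}$) is $g(\mathbf{x}):=\sup_{\mathbf{s}\in\mathcal{X}}(\mathbf{x}-\mathbf{s})^\top\nabla f(\mathbf{x})$ for $\mathbf{x}\in\mathcal{X}$. Randomized block Frank-Wolfe algorithm. Start from a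 (deterministic) $\mathbf{x}^0\in\mathcal{X}$. At iteration $t=0,1,\ldots$: draw $\mathcal{B}_t$ uniformly at random among all subsets of $\mathcal{N}_b$ with exactly $B$ elements, independently of previous draws; for each $n\in\mathcal{B}_t$ pick a minimizer $\mathbf{s}_n^t\in\arg\min_{\mathbf{s}_n\in\mathcal{X}_n}\langle \mathbf{s}_n,\nabla_{\mathbf{x}_n}f(\mathbf{x}^t)\rangle$ (ties broken arbitrarily, as a function of the draws $\mathcal{B}_0,\ldots,\mathcal{B}_t$); set $\mathbf{x}_n^{t+1}=(1-\gamma_t)\mathbf{x}_n^t+\gamma_t\mathbf{s}_n^t$ for $n\in\mathcal{B}_t$ and $\mathbf{x}_n^{t+1}=\mathbf{x}_n^t$ for $n\notin\mathcal{B}_t$. Expectations are over the random draws. Standing assumption: the curvature constant $$C_f:=\sup_{\gamma\in(0,1],\ \mathbf{x},\mathbf{s}\in\mathcal{X},\ \mathbf{y}=(1-\gamma)\mathbf{x}+\gamma\mathbf{s}}\ \frac{2}{\gamma^2}\left[f(\mathbf{y})-f(\mathbf{x})-\langle\mathbf{y}-\mathbf{x},\nabla f(\mathbf{x})\rangle\right]$$ is finite. *)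

(* Defs.v *)
From mathcomp Require Import all_boot all_order all_algebra.
From mathcomp Require Import all_classical all_reals all_analysis.
Set Implicit Arguments.
Unset Strict Implicit.
Unset Printing Implicit Defensive.
Import Order.TTheory GRing.Theory Num.Theory.
Import numFieldNormedType.Exports.
Local Open Scope classical_set_scope.
Local Open Scope ring_scope.

Definition dot (R : realType) (m : nat) (u v : 'rV[R]_m) : R :=
  \sum_(i < m) u 0 i * v 0 i.

(* The vector of partial derivatives; 'D_v is only meaningful where the
   function is differentiable. *)
Definition grad (R : realType) (m : nat) (f : 'rV[R]_m -> R) (x : 'rV[R]_m) :
    'rV[R]_m :=
  \row_(i < m) 'D_(delta_mx 0 i) f x.

Definition argmin_linear (R : realType) (m : nat) (A : set 'rV[R]_m)
    (c : 'rV[R]_m) : set 'rV[R]_m :=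
  [set s | A s /\ forall v, A v -> dot s c <= dot v c].

(* Block n has its own dimension d n, and a vector of R^(sum of the d n) is
   split into its blocks by submxrow. *)
Definition feasible (R : realType) (N : nat) (d : 'I_N -> nat)
    (X : forall n : 'I_N, set 'rV[R]_(d n)) : set 'rV[R]_(\sum_(n < N) d n) :=
  [set x | forall n, X n (submxrow x n)].

(* A supremum of real numbers; it is a genuine one when A is nonempty and
   compact. *)
Definition duality_gap (R : realType) (m : nat) (A : set 'rV[R]_m)
    (f : 'rV[R]_m -> R) (x : 'rV[R]_m) : R :=
  sup [set dot (x - s) (grad f x) | s in A].

Definition curvature_constant (R : realType) (m : nat) (A : set 'rV[R]_m)
    (f : 'rV[R]_m -> R) : \bar R :=
  ereal_sup [set c : \bar R |
    exists (gamma : R) (x s y : 'rV[R]_m),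
      [/\ 0 < gamma <= 1, A x, A s, y = (1 - gamma) *: x + gamma *: s &
          c = (2 / gamma ^+ 2 * (f y - f x - dot (y - x) (grad f x)))%:E]].

(* The finite type {set 'I_N} carries its discrete sigma-algebra: every set of
   values is an event. *)
Definition measurable_draws (N : nat) (disp : measure_display)
    (T : measurableType disp) (draw : nat -> T -> {set 'I_N}) : Prop :=
  forall t (E : set {set 'I_N}), measurable (draw t @^-1` E).

Definition uniform_draws (R : realType) (N B : nat) (disp : measure_display)
    (T : measurableType disp) (P : probability T R)
    (draw : nat -> T -> {set 'I_N}) : Prop :=
  forall t (A : {set 'I_N}),
    P (draw t @^-1` [set A]) =
    (if #|A| == B then ('C(N, B)%:R : R)^-1 else 0)%:E.

Definition independent_draws (R : realType) (N : nat) (disp : measure_display)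
    (T : measurableType disp) (P : probability T R)
    (draw : nat -> T -> {set 'I_N}) : Prop :=
  forall (J : seq nat) (E : nat -> set {set 'I_N}), uniq J ->
    P (\bigcap_(t in [set` J]) (draw t @^-1` E t)) =
    (\big[*%E/1%E]_(t <- J) P (draw t @^-1` E t))%E.

(* s t w n is the minimizer picked for block n at iteration t; it is
   constrained only for the blocks n that are drawn. *)
Record rbfw_run (R : realType) (N : nat) (d : 'I_N -> nat)
    (X : forall n : 'I_N, set 'rV[R]_(d n))
    (f : 'rV[R]_(\sum_(n < N) d n) -> R) (gamma : nat -> R)
    (x0 : 'rV[R]_(\sum_(n < N) d n)) (T : Type)
    (draw : nat -> T -> {set 'I_N})
    (s : nat -> T -> forall n : 'I_N, 'rV[R]_(d n))
    (x : nat -> T -> 'rV[R]_(\sum_(n < N) d n)) : Prop := {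
  run_init : forall w, x 0%N w = x0 ;
  run_argmin : forall t w n, n \in draw t w ->
    argmin_linear (X n) (submxrow (grad f (x t w)) n) (s t w n) ;
  (* ties are broken as a function of the draws 0, ..., t *)
  run_adapted : forall t w w',
    (forall k, (k <= t)%N -> draw k w = draw k w') ->
    forall n, n \in draw t w -> s t w n = s t w' n ;
  run_update : forall t w n,
    submxrow (x t.+1 w) n =
    if n \in draw t w
    then (1 - gamma t) *: submxrow (x t w) n + gamma t *: s t w n
    else submxrow (x t w) n }.

(* The minimum over k <= t; +oo is neutral for mine and the range is never
   empty. *)
Definition best_expected_gap (R : realType) (m : nat) (A : set 'rV[R]_m)
    (f : 'rV[R]_m -> R) (disp : measure_display) (T : measurableType disp)
    (P : probability T R) (x : nat -> T -> 'rV[R]_m) (t : nat) : \bar R :=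
  (\big[mine/+oo]_(k < t.+1) 'E_P[fun w => duality_gap A f (x k w)])%E.

(* Main.v *)
(* One step of the algorithm moves x^t towards the feasible point that agrees
   with s_n^t on the drawn blocks and with x^t elsewhere, so the curvature
   constant gives
     f(x^{t+1}) <= f(x^t) - gamma_t * sum_(n in B_t) g_n(x^t)
                   + gamma_t^2 C_f / 2,
   where the block gaps g_n sum to the duality gap g.  Block n is drawn with
   probability alpha, independently of x^t, hence in expectation the middle term
   is gamma_t * alpha * E[g(x^t)].  Summing over t, with f bounded below on the
   compact feasible set, sum_t gamma_t^2 bounded and sum_(k <= t) gamma_k at
   least log t, yields min_(k <= t) E[g(x^k)] = O(1 / log t). *)

Require Import Defs.
From mathcomp Require Import all_boot all_order all_algebra.
From mathcomp Require Import all_classical all_reals all_analysis.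
From mathcomp Require Import ring lra.
Set Implicit Arguments.
Unset Strict Implicit.
Unset Printing Implicit Defensive.
Import Order.TTheory GRing.Theory Num.Theory.
Import numFieldNormedType.Exports.
Local Open Scope classical_set_scope.
Local Open Scope ring_scope.

(** * Step sizes *)

(** Since [a <= 1], the denominator lies between [a * (t+1)] and [2 * (t+1)]. The lower bound on the
    step makes the step sums diverge like the harmonic series; the bound on its square makes the
    squares summable. *)
Lemma step_bounds (R : realType) (a : R) (t : nat) : 0 < a <= 1 ->
  [/\ 0 < 2 / (a * t%:R + 2) <= 1,
      (t.+1%:R)^-1 <= 2 / (a * t%:R + 2) &
      (2 / (a * t%:R + 2)) ^+ 2 <= 4 / a ^+ 2 * (t.+1%:R) ^- 2].
Proof.
move=> /andP[a0 a1]; have t0 : 0 <= t%:R :> R by [].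
have at0 : 0 <= a * t%:R by apply: mulr_ge0 => //; exact: ltW.
have att : a * t%:R <= t%:R by rewrite ler_piMl.
have t1 : 0 < t.+1%:R :> R by [].
have d0 : 0 < a * t%:R + 2 by lra.
split.
- by rewrite divr_gt0 //= ler_pdivrMr // mul1r lerDr.
- rewrite -div1r ler_pdivrMr // mulrAC ler_pdivlMr // -natr1; lra.
- have -> : 4 / a ^+ 2 * t.+1%:R ^- 2 = (2 / (a * t.+1%:R)) ^+ 2.
    rewrite !expr_div_n exprMn; field; by rewrite !gt_eqF.
  have at1 : 0 < a * t.+1%:R by apply: mulr_gt0.
  rewrite ler_pXn2r // ?nnegrE; first last.
  - by apply: ltW; rewrite divr_gt0.
  - by apply: ltW; rewrite divr_gt0.
  rewrite ler_wpM2l // lef_pV2 ?posrE // -natr1; lra.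
Qed.

Lemma sum_inv_square_le2 (R : realType) (t : nat) :
  \sum_(k < t) (k.+1%:R : R) ^- 2 <= 2.
Proof.
(* The induction needs the sharper bound [2 - 1/(t+1)]. With [u = t+1], its increment exceeds the
   added term by [1/u - 1/(u+1) - 1/(u+1)^2 = 1/(u (u+1)^2)], which is nonnegative. *)
suff : \sum_(k < t.+1) (k.+1%:R : R) ^- 2 <= 2 - (t.+1%:R)^-1.
  rewrite big_ord_recr /= => h; apply: le_trans (le_trans h _).
    by rewrite lerDl invr_ge0 exprn_ge0.
  by rewrite gerBl invr_ge0.
elim: t => [|t ih].
  by rewrite big_ord_recr big_ord0 /= add0r expr1n invr1; lra.
rewrite big_ord_recr /=; apply: le_trans (lerD ih (lexx _)) _.
have p1 : 0 < t.+1%:R :> R by [].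
have p2 : 0 < t.+2%:R :> R by [].
rewrite -addrA lerD2l -lerN2 opprD !opprK lerBrDr.
have e : t.+2%:R = t.+1%:R + 1 :> R by rewrite natr1.
rewrite e; set u := t.+1%:R : R.
have u0 : 0 < u by [].
rewrite -subr_ge0.
have -> : u^-1 - ((u + 1)^-1 + (u + 1) ^- 2) = u^-1 * (u + 1) ^- 2.
  by field; rewrite !gt_eqF // ltr_wpDr.
by rewrite mulr_ge0 ?invr_ge0 ?exprn_ge0 // addr_ge0.
Qed.

(** The increment of the logarithm is [ln (1 + 1/(t+1))], and [ln (1 + x) <= x]. *)
Lemma ln_le_harmonic (R : realType) (t : nat) :
  ln (t.+1%:R : R) <= \sum_(k < t) (k.+1%:R : R)^-1.
Proof.
elim: t => [|t ih]; first by rewrite big_ord0 ln1.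
rewrite big_ord_recr /=.
have p1 : 0 < t.+1%:R :> R by [].
have -> : t.+2%:R = t.+1%:R * (1 + t.+1%:R^-1) :> R.
  by rewrite mulrDr mulr1 divff ?gt_eqF // natr1.
rewrite lnM ?posrE // ?ltr_wpDr ?invr_ge0 //.
apply: lerD ih _; apply: le_ln1Dx.
by apply: lt_le_trans (_ : 0 <= _); rewrite ?invr_ge0 // ltrN10.
Qed.

(** The deterministic core: [F] stands for the mean objective, [G] for the mean duality gap, [C] for
    the curvature constant and [b] for the running minimum of [G]. Telescoping the descent
    inequality leaves [b] times a divergent sum below a bounded quantity. *)
Lemma descent_rate (R : realType) (a C m : R) (F G : nat -> R)
    (gam := fun t : nat => 2 / (a * t%:R + 2) : R) (t : nat) (b : R) :
  0 < a <= 1 -> 0 <= C -> (forall k, m <= F k) ->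
  (forall k, F k.+1 <= F k - gam k * (a * G k) + gam k ^+ 2 / 2 * C) ->
  0 <= b -> (forall k, (k <= t)%N -> b <= G k) ->
  a * b * ln t%:R <= F 0%N - m + 4 / a ^+ 2 * C.
Proof.
move=> a01 C0 mF step b0 bG.
have /andP[a0 a1] := a01.
(* The range stops at [t.+1] because [b <= G k] is known only for [k <= t]. *)
have tel n : (n <= t.+1)%N ->
    a * b * \sum_(k < n) gam k <=
    F 0%N - F n + C / 2 * \sum_(k < n) gam k ^+ 2.
  elim: n => [|n ih] nt; first by rewrite !big_ord0 !mulr0 subrr addr0.
  rewrite !big_ord_recr /= !mulrDr.
  have := ih (ltnW nt); have := step n.
  have [/andP[g0 _] _ _] := step_bounds n a01.
  have : a * b * gam n <= gam n * (a * G n).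
    rewrite mulrC ler_pM2l // ler_pM2l //; exact: bG.
  rewrite -/(gam n) (_ : C / 2 * gam n ^+ 2 = gam n ^+ 2 / 2 * C); last by ring.
  move: (\sum_(_ < n) gam _) (\sum_(_ < n) gam _ ^+ 2) => A B; lra.
have := tel t.+1 (leqnn _).
(* The factor [4 / a ^+ 2] comes from [step_bounds] and the 2 from the inverse squares; multiplied
   by [C / 2], they give the final [4 / a ^+ 2 * C]. *)
have S2 : \sum_(k < t.+1) gam k ^+ 2 <= 4 / a ^+ 2 * 2.
  apply: le_trans (_ : \sum_(k < t.+1) (4 / a ^+ 2 * (k.+1%:R) ^- 2) <= _).
    by apply: ler_sum => k _; have [] := step_bounds k a01.
  rewrite -mulr_sumr ler_wpM2l ?sum_inv_square_le2 //.
  by rewrite divr_ge0 // exprn_ge0 // ltW.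
have S1 : ln t%:R <= \sum_(k < t.+1) gam k.
  (* The [t.+1] steps dominate [ln t.+2], weakened here to [ln t]; at [t = 0] the convention that
     [ln 0] is 0 applies. *)
  apply: le_trans (_ : ln t.+2%:R <= _).
    case: t {bG tel S2} => [|t]; first by rewrite ln0 // ln_ge0 // ler1n.
    by rewrite ler_ln ?posrE // ler_nat ltnW.
  apply: le_trans (ln_le_harmonic _ _) _.
  by apply: ler_sum => k _; have [] := step_bounds k a01.
have S1' : a * b * ln t%:R <= a * b * \sum_(k < t.+1) gam k.
  by rewrite ler_wpM2l // mulr_ge0 // ltW.
have S2' : C / 2 * \sum_(k < t.+1) gam k ^+ 2 <= C / 2 * (4 / a ^+ 2 * 2).
  by rewrite ler_wpM2l // divr_ge0.
have -> : 4 / a ^+ 2 * C = C / 2 * (4 / a ^+ 2 * 2) by field; rewrite gt_eqF.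
have := mF t.+1; lra.
Qed.

(** * Block structure and duality gap *)

Lemma dot_submxrow (R : realType) (N : nat) (d : 'I_N -> nat)
    (u v : 'rV[R]_(\sum_(n < N) d n)) :
  dot u v = \sum_n dot (submxrow u n) (submxrow v n).
Proof.
have dotE m (a b : 'rV[R]_m) : dot a b = (a *m b^T) 0 0.
  by rewrite mxE; apply: eq_bigr => i _; rewrite mxE.
rewrite dotE -[in LHS](submxrowK u) -[in LHS](submxrowK v) tr_mxrow.
rewrite mul_mxrow_mxcol summxE.
by apply: eq_bigr => n _; rewrite dotE.
Qed.

Lemma dotBl (R : realType) (m : nat) (a b c : 'rV[R]_m) :
  dot (a - b) c = dot a c - dot b c.
Proof.
by rewrite /dot -sumrB; apply: eq_bigr => i _; rewrite !mxE mulrBl.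
Qed.

Lemma dotZl (R : realType) (m : nat) (k : R) (a b : 'rV[R]_m) :
  dot (k *: a) b = k * dot a b.
Proof.
by rewrite /dot mulr_sumr; apply: eq_bigr => i _; rewrite !mxE mulrA.
Qed.

Lemma dot0l (R : realType) (m : nat) (b : 'rV[R]_m) : dot 0 b = 0.
Proof. by rewrite /dot big1 // => i _; rewrite !mxE mul0r. Qed.

Lemma dot_continuous (R : realType) (m : nat) (c : 'rV[R]_m) :
  continuous (fun u : 'rV[R]_m => dot u c).
Proof.
apply: continuous_big => [|i _ u]; first exact: add_continuous.
apply: (@continuousM _ _ (fun x : 'rV[R]_m => x 0 i) (cst (c 0 i))).
  exact: coord_continuous.
exact: cst_continuous.
Qed.

Lemma argmin_linear_nonempty (R : realType) (m : nat) (A : set 'rV[R]_m)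
    (c : 'rV[R]_m) : A !=set0 -> compact A -> argmin_linear A c !=set0.
Proof.
move=> A0 cA.
have [v vA vmin] := EVT_min_rV A0 cA
  (continuous_subspaceT (dot_continuous (c := c))).
exists v; split; first exact/set_mem.
by move=> u Au; apply: vmin; exact/mem_set.
Qed.

Lemma submxrow_continuous (R : realType) (N : nat) (d : 'I_N -> nat)
    (n : 'I_N) :
  continuous (fun x : 'rV[R]_(\sum_(n < N) d n) => submxrow x n).
Proof.
move=> x A /nbhs_ballP [e e0 eA]; apply/nbhs_ballP; exists e => //= y [_ xy].
by apply: eA; split => // i j; rewrite !mxE; exact: xy.
Qed.

(** A closed set inside a compact box: coordinate [i] of a feasible vector is entry [tagnat.sig2 i]
    of block [tagnat.sig1 i], so it ranges over a continuous image of a compact block. Closedness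
    holds because the set is an intersection of preimages of closed blocks under continuous block
    extraction. *)
Lemma compact_feasible (R : realType) (N : nat) (d : 'I_N -> nat)
    (X : forall n : 'I_N, set 'rV[R]_(d n)) :
  (forall n, compact (X n)) -> compact (feasible X).
Proof.
move=> cX.
pose K (i : 'I_(\sum_(n < N) d n)) : set R :=
  (fun v : 'rV[R]_(d (tagnat.sig1 i)) => v 0 (tagnat.sig2 i)) @`
  X (tagnat.sig1 i).
apply: (@subclosed_compact _ _ [set v : 'rV[R]__ | forall i, K i (v ord0 i)]).
- rewrite (_ : feasible X = \bigcap_n ((fun x => submxrow x n) @^-1` X n)).
    apply: closed_bigI => n _; apply: preimage_closed.
      by move=> x _; exact: submxrow_continuous.
    exact: compact_closed.
  by apply/seteqP; split => x h n; [move=> _|]; apply: h.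
- apply: rV_compact => i; apply: continuous_compact => //.
  by apply: continuous_subspaceT; exact: coord_continuous.
- move=> x Xx i; exists (submxrow x (tagnat.sig1 i)); first exact: Xx.
  by rewrite !mxE tagnat.sig2K.
Qed.

Lemma convex_set_comb (R : realType) (m : nat) (A : set 'rV[R]_m) (g : R)
    (u v : 'rV[R]_m) :
  convex_set A -> 0 <= g <= 1 -> A u -> A v -> A ((1 - g) *: u + g *: v).
Proof.
move=> cA /andP[g0 g1] Au Av.
have := cA v u (Itv01 g0 g1) (mem_set Av) (mem_set Au).
by move/set_mem; rewrite addrC.
Qed.

(** A selection depending on [x] alone, unlike the minimizers picked by a run, whose ties may depend
    on the draws. The default 0 is harmless once the argmin is known to be nonempty. *)
Definition block_min (R : realType) (N : nat) (d : 'I_N -> nat)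
    (X : forall n : 'I_N, set 'rV[R]_(d n)) (f : 'rV[R]_(\sum_(n < N) d n) -> R)
    (x : 'rV[R]_(\sum_(n < N) d n)) (n : 'I_N) : 'rV[R]_(d n) :=
  xget 0 (argmin_linear (X n) (submxrow (grad f x) n)).

Definition block_gap (R : realType) (N : nat) (d : 'I_N -> nat)
    (X : forall n : 'I_N, set 'rV[R]_(d n)) (f : 'rV[R]_(\sum_(n < N) d n) -> R)
    (x : 'rV[R]_(\sum_(n < N) d n)) (n : 'I_N) : R :=
  dot (submxrow x n - block_min X f x n) (submxrow (grad f x) n).

Lemma block_minP (R : realType) (N : nat) (d : 'I_N -> nat)
    (X : forall n : 'I_N, set 'rV[R]_(d n)) (f : 'rV[R]_(\sum_(n < N) d n) -> R)
    (x : 'rV[R]_(\sum_(n < N) d n)) (n : 'I_N) :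
  X n !=set0 -> compact (X n) ->
  argmin_linear (X n) (submxrow (grad f x) n) (block_min X f x n).
Proof.
by move=> X0 cX; apply: xgetPex; exact: argmin_linear_nonempty.
Qed.

(** All minimizers share the same linear value, so the way a run breaks ties does not affect the
    gap. *)
Lemma block_gap_argmin (R : realType) (N : nat) (d : 'I_N -> nat)
    (X : forall n : 'I_N, set 'rV[R]_(d n)) (f : 'rV[R]_(\sum_(n < N) d n) -> R)
    (x : 'rV[R]_(\sum_(n < N) d n)) (n : 'I_N) (s : 'rV[R]_(d n)) :
  argmin_linear (X n) (submxrow (grad f x) n) s ->
  block_gap X f x n = dot (submxrow x n - s) (submxrow (grad f x) n).
Proof.
move=> [Xs smin]; rewrite /block_gap !dotBl; congr (_ - _).
have [Xv vmin] :
    argmin_linear (X n) (submxrow (grad f x) n) (block_min X f x n).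
  by apply: xgetPex; exists s; split.
by apply/eqP; rewrite eq_le vmin // smin.
Qed.

Lemma submxrowB (R : realType) (N : nat) (d : 'I_N -> nat)
    (u v : 'rV[R]_(\sum_(n < N) d n)) (n : 'I_N) :
  submxrow (u - v) n = submxrow u n - submxrow v n.
Proof. by apply/matrixP => i j; rewrite !mxE. Qed.

(** A linear function on a product is minimized block by block, so the vector [v] assembled from the
    block minimizers attains the supremum. *)
Lemma duality_gapE (R : realType) (N : nat) (d : 'I_N -> nat)
    (X : forall n : 'I_N, set 'rV[R]_(d n)) (f : 'rV[R]_(\sum_(n < N) d n) -> R)
    (x : 'rV[R]_(\sum_(n < N) d n)) :
  (forall n, X n !=set0) -> (forall n, compact (X n)) ->
  duality_gap (feasible X) f x = \sum_n block_gap X f x n.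
Proof.
move=> X0 cX.
pose v := \mxrow_n block_min X f x n.
have bP n := block_minP f x (X0 n) (cX n).
have Xv : feasible X v by move=> n; rewrite mxrowK; have [] := bP n.
have -> : \sum_n block_gap X f x n = dot (x - v) (grad f x).
  by rewrite dot_submxrow; apply: eq_bigr => n _; rewrite submxrowB mxrowK.
have ub : ubound [set dot (x - s) (grad f x) | s in feasible X]
    (dot (x - v) (grad f x)).
  move=> _ [s Xs <-]; rewrite !dotBl lerD2l lerN2 !dot_submxrow.
  by apply: ler_sum => n _; rewrite mxrowK; apply: (bP n).2; exact: Xs.
apply/eqP; rewrite eq_le; apply/andP; split.
  by apply: ge_sup => //; exists (dot (x - v) (grad f x)), v.
by apply: ub_le_sup; [exists (dot (x - v) (grad f x))|exists v].
Qed.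

Lemma curvature_bound (R : realType) (m : nat) (A : set 'rV[R]_m)
    (f : 'rV[R]_m -> R) (g : R) (x s : 'rV[R]_m)
    (y := (1 - g) *: x + g *: s) :
  curvature_constant A f \is a fin_num -> 0 < g <= 1 -> A x -> A s ->
  f y <= f x + g * dot (s - x) (grad f x)
         + g ^+ 2 / 2 * fine (curvature_constant A f).
Proof.
move=> fC g01 Ax As; have /andP[g0 _] := g01.
have yx : y - x = g *: (s - x).
  by apply/rowP => i; rewrite !mxE; ring.
have : ((2 / g ^+ 2 * (f y - f x - dot (y - x) (grad f x)))%:E <=
   curvature_constant A f)%E.
  by apply: ereal_sup_ubound; exists g, x, s, y; split.
rewrite -[X in (_ <= X)%E](fineK fC) lee_fin yx dotZl => h.
have g2 : 0 < g ^+ 2 / 2 by rewrite divr_gt0 // exprn_gt0.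
have := ler_wpM2l (ltW g2) h.
set D := f y - _ - _.
have -> : g ^+ 2 / 2 * (2 / g ^+ 2 * D) = D by field; rewrite gt_eqF.
rewrite /D; lra.
Qed.

(** With step 1 and [s = x] the curvature bound collapses to [0 <= C / 2]. *)
Lemma curvature_ge0 (R : realType) (m : nat) (A : set 'rV[R]_m)
    (f : 'rV[R]_m -> R) :
  A !=set0 -> curvature_constant A f \is a fin_num ->
  0 <= fine (curvature_constant A f).
Proof.
move=> [x Ax] fC; have g01 : 0 < (1 : R) <= 1 by rewrite ltr01 lexx.
have := curvature_bound fC g01 Ax Ax.
rewrite (subrr x) dot0l mulr0 subrr scale0r add0r scale1r addr0 expr1n => h.
by move: h; rewrite lerDl pmulr_rge0.
Qed.

(** * Random draws *)

(** Writing a function of a finite-valued variable as a finite combination of indicators makes its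
    integrability and expectation depend only on the events [Y = i]. No measurability of [f], of its
    gradient or of the minimizers has to be discussed. *)
Lemma finite_valued_decomp (R : realType) (T : Type) (I : finType) (Y : T -> I)
    (phi : I -> R) (w : T) :
  (phi (Y w))%:E = (\sum_i (phi i)%:E * (\1_(Y @^-1` [set i]) w)%:E)%E.
Proof.
rewrite (bigD1 (Y w)) //= indicE mem_set //= mule1 big1 ?adde0 // => i iw.
rewrite indicE memNset ?mule0 //= => e; by rewrite e eqxx in iw.
Qed.

Lemma finite_valued_Lfun (R : realType) (disp : measure_display)
    (T : measurableType disp) (P : probability T R) (I : finType) (Y : T -> I)
    (phi : I -> R) :
  (forall i, measurable (Y @^-1` [set i])) -> phi \o Y \in Lfun P 1.
Proof.
move=> mY; apply/Lfun1_integrable.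
rewrite (_ : EFin \o _ =
    fun w => (\sum_i (phi i)%:E * (\1_(Y @^-1` [set i]) w)%:E)%E); last first.
  by apply/funext => w; exact: finite_valued_decomp.
apply: integrable_sum => // i _; apply: integrableZl => //.
exact: integrable_indic.
Qed.

Lemma expectation_finite_valued (R : realType) (disp : measure_display)
    (T : measurableType disp) (P : probability T R) (I : finType) (Y : T -> I)
    (phi : I -> R) :
  (forall i, measurable (Y @^-1` [set i])) ->
  'E_P[phi \o Y]%E = (\sum_i (phi i)%:E * P (Y @^-1` [set i]))%E.
Proof.
move=> mY; rewrite unlock.
rewrite (eq_integral
    (fun w => (\sum_i (phi i)%:E * (\1_(Y @^-1` [set i]) w)%:E)%E)); last first.
  by move=> w _; exact: finite_valued_decomp.
have ii i : P.-integrable setT (EFin \o (\1_(Y @^-1` [set i]) : T -> R)).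
  exact: integrable_indic.
rewrite integral_sum //; last by move=> i; apply: integrableZl => //; exact: ii.
apply: eq_bigr => i _; rewrite integralZl //; last exact: ii.
by rewrite integral_indic // setIT.
Qed.

Lemma expectation_le_Lfun (R : realType) (disp : measure_display)
    (T : measurableType disp) (P : probability T R) (Y Z : T -> R) :
  Y \in Lfun P 1 -> Z \in Lfun P 1 -> (forall w, Y w <= Z w) ->
  ('E_P[Y] <= 'E_P[Z])%E.
Proof.
move=> LY LZ YZ; rewrite -sube_ge0; last by rewrite expectation_fin_num.
rewrite -expectationB //; apply: expectation_ge0 => w /=.
by rewrite subr_ge0.
Qed.

(** Replaces measurability for the sigma-algebra generated by the draws before [k]: since these
    draws take finitely many values, functional dependence is enough. *)
Definition adapted (N : nat) (T A : Type) (draw : nat -> T -> {set 'I_N})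
    (k : nat) (Z : T -> A) : Prop :=
  forall w w', (forall i, (i < k)%N -> draw i w = draw i w') -> Z w = Z w'.

(** The draws before [k] packed into one variable with values in a finite type, to which the
    finite-valued lemmas apply. *)
Definition history (N : nat) (T : Type) (draw : nat -> T -> {set 'I_N})
    (k : nat) (w : T) : {ffun 'I_k -> {set 'I_N}} := [ffun i => draw (val i) w].

Lemma history_preimage (N : nat) (T : Type) (draw : nat -> T -> {set 'I_N})
    (k : nat) (h : {ffun 'I_k -> {set 'I_N}}) (E : nat -> set {set 'I_N}) :
  (forall i : 'I_k, E i = [set h i]) ->
  history draw k @^-1` [set h] =
  \bigcap_(t in [set` iota 0 k]) (draw t @^-1` E t).
Proof.
move=> Eh; apply/seteqP; split => w /=.
  move=> hw t /=; rewrite mem_iota /= add0n => tk.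
  by rewrite (Eh (Ordinal tk)) /= -hw ffunE.
move=> H; apply/ffunP => i; rewrite ffunE.
have := H (val i); rewrite /= mem_iota /= add0n ltn_ord => /(_ isT).
by rewrite Eh.
Qed.

Lemma measurable_history (N : nat) (disp : measure_display)
    (T : measurableType disp) (draw : nat -> T -> {set 'I_N}) (k : nat)
    (h : {ffun 'I_k -> {set 'I_N}}) :
  measurable_draws draw -> measurable (history draw k @^-1` [set h]).
Proof.
move=> mdraw.
(* The family of events is indexed by all of [nat]; past [k], where [insub] fails, the whole space
   is a filler. *)
rewrite (@history_preimage _ _ _ _ _
  (fun t => if insub t is Some i then [set h i] else setT)); last first.
  by move=> i; rewrite valK.
by apply: bigcap_measurableType => t _; exact: mdraw.
Qed.

Lemma adapted_factor (N : nat) (T A : Type) (draw : nat -> T -> {set 'I_N})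
    (k : nat) (Z : T -> A) (a : A) :
  adapted draw k Z -> exists phi, Z = phi \o history draw k.
Proof.
move=> aZ.
(* For a history that occurs, any outcome producing it may be chosen, by adaptedness; [a] fills in
   for histories that never occur. *)
exists (fun h => if pselect (exists w, history draw k w = h) is left e
                 then Z (projT1 (cid e)) else a).
apply/funext => w /=; case: pselect => [e|[]]; last by exists w.
case: cid => w' /= /ffunP h; apply: aZ => i ik.
by have := h (Ordinal ik); rewrite !ffunE.
Qed.

Lemma adapted_Lfun (R : realType) (N : nat) (disp : measure_display)
    (T : measurableType disp) (P : probability T R)
    (draw : nat -> T -> {set 'I_N}) (k : nat) (Z : T -> R) :
  measurable_draws draw -> adapted draw k Z -> Z \in Lfun P 1.
Proof.
move=> mdraw /(adapted_factor 0) [phi ->].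
by apply: finite_valued_Lfun => h; exact: measurable_history.
Qed.

Lemma card_draws_notin (N B : nat) (n : 'I_N) :
  #|[set A : {set 'I_N} | (n \notin A) && (#|A| == B)]%SET| = 'C(N.-1, B).
Proof.
have <- : #|[set~ n]%SET| = N.-1 by rewrite cardsC1 card_ord.
rewrite -cards_draws; apply: eq_card => A; rewrite !inE.
congr (_ && _).
apply/idP/idP => [nA|/fintype.subsetP sA].
  apply/fintype.subsetP => i iA.
  by rewrite !inE; apply: contraNneq nA => <-.
by apply/negP => /sA; rewrite !inE eqxx.
Qed.

(** The proportion [B / N] of draws containing [n], multiplied out to stay in [nat]. Removing the
    draws that avoid [n] leaves, by Pascal's rule, ['C(N.-1, B.-1)] draws when [B] is positive; the
    absorption identity for binomials concludes. *)
Lemma card_draws_in (N B : nat) (n : 'I_N) :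
  (B * 'C(N, B) =
   N * #|[set A : {set 'I_N} | (n \in A) && (#|A| == B)]%SET|)%N.
Proof.
have N0 : (0 < N)%N by apply: leq_ltn_trans (ltn_ord n).
have : ('C(N, B) = #|[set A : {set 'I_N} | (n \in A) && (#|A| == B)]%SET|
   + 'C(N.-1, B))%N.
  rewrite -(card_draws_notin B n) -[X in 'C(X, _)]card_ord -card_draws.
  rewrite -[LHS](cardsID [set A : {set 'I_N} | n \in A]%SET); congr (_ + _)%N.
    by apply: eq_card => A; rewrite !inE andbC.
  by apply: eq_card => A; rewrite !inE.
case: N n N0 => // N n _; case: B => [|B].
  rewrite !bin0 mul0n /= => /eqP; rewrite -[X in X == _]add0n eqn_add2r.
  by move/eqP <-; rewrite muln0.
rewrite -mul_bin_diag /= binS addnC => /eqP.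
by rewrite eqn_add2r => /eqP <-.
Qed.

Lemma prob_draw_in (R : realType) (N B : nat) (disp : measure_display)
    (T : measurableType disp) (P : probability T R)
    (draw : nat -> T -> {set 'I_N}) (t : nat) (n : 'I_N) :
  (B <= N)%N -> measurable_draws draw -> uniform_draws B P draw ->
  P (draw t @^-1` [set A : {set 'I_N} | n \in A]) = (B%:R / N%:R)%:E.
Proof.
move=> BN mdraw udraw.
have N0 : (0 < N)%N by apply: leq_ltn_trans (ltn_ord n).
rewrite -expectation_indic; last exact: mdraw.
rewrite (_ : \1__ = (fun A : {set 'I_N} => (n \in A)%:R : R) \o draw t);
  last first.
  apply/funext => w; rewrite indicE /=; congr (nat_of_bool _)%:R.
  by apply/idP/idP => [/set_mem//|h]; apply/mem_set.
rewrite expectation_finite_valued; last by move=> A; exact: mdraw.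
under eq_bigr do rewrite udraw -EFinM.
rewrite sumEFin; congr (_%:E).
(* Only the sets of size [B] containing [n] contribute, each with weight [1 / 'C(N, B)]. *)
rewrite (bigID (fun A : {set 'I_N} => (n \in A) && (#|A| == B))) /=.
rewrite [X in _ + X]big1 ?addr0; last first.
  move=> A; rewrite negb_and; case: (n \in A) => /=; last by rewrite mul0r.
  by move/negbTE ->; rewrite mulr0.
under eq_bigr => A /andP[-> ->] do rewrite mul1r.
rewrite sumr_const -[_ *+ _]mulr_natl.
have C0 : ('C(N, B)%:R : R) != 0 by rewrite pnatr_eq0 -lt0n bin_gt0.
have N0' : (N%:R : R) != 0 by rewrite pnatr_eq0 -lt0n.
apply/eqP; rewrite eqr_div // -!natrM mulnC [X in _ == X%:R](card_draws_in B n).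
by apply/eqP; congr (_ * _)%:R; apply: eq_card => A; rewrite !inE.
Qed.

(* The draw of step k is independent of everything decided before it. *)
Lemma expectation_adapted_draw (R : realType) (N B : nat)
    (disp : measure_display) (T : measurableType disp) (P : probability T R)
    (draw : nat -> T -> {set 'I_N}) (k : nat) (n : 'I_N) (Z : T -> R) :
  (B <= N)%N -> measurable_draws draw -> uniform_draws B P draw ->
  independent_draws P draw -> adapted draw k Z ->
  'E_P[fun w => ((n \in draw k w)%:R * Z w)%R]%E =
  ((B%:R / N%:R)%:E * 'E_P[Z])%E.
Proof.
move=> BN mdraw udraw idraw /(adapted_factor 0) [phi ->].
(* The pair is again finite-valued, so both expectations become finite sums over histories, compared
   term by term. *)
pose Y w := (history draw k w, n \in draw k w).
have YE h b : Y @^-1` [set (h, b)] =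
    history draw k @^-1` [set h] `&`
    draw k @^-1` [set A : {set 'I_N} | (n \in A) = b].
  by apply/seteqP; split => w /=; [case=> <- <-|rewrite /Y => -[-> ->]].
have mH h : measurable (history draw k @^-1` [set h]).
  exact: measurable_history.
rewrite (_ : (fun w => _) = (fun hb : _ * bool => hb.2%:R * phi hb.1) \o Y) //.
rewrite expectation_finite_valued; last first.
  by move=> [h b]; rewrite YE; apply: measurableI => //; exact: mdraw.
rewrite expectation_finite_valued //.
transitivity (\sum_h \sum_b
    (((b : bool)%:R * phi h)%:E * P (Y @^-1` [set (h, b)])))%E.
  by rewrite pair_bigA /=; apply: eq_bigr => -[].
have fP (A : set T) : measurable A -> P A \is a fin_num.
  by exact: fin_num_measure.
under [in RHS]eq_bigr => h _ do rewrite -(fineK (fP _ (mH h))) -EFinM.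
rewrite sumEFin -EFinM mulr_sumr -sumEFin; apply: eq_bigr => h _.
rewrite big_bool /= mul0r mul0e adde0 mul1r YE.
have -> : P (history draw k @^-1` [set h] `&`
             draw k @^-1` [set A : {set 'I_N} | (n \in A) = true])
    = (P (history draw k @^-1` [set h]) * (B%:R / N%:R)%:E)%E.
  (* One family serves two uses of independence: over the times before [k] it describes the history,
     and adding time [k], where [insub] fails, adjoins the event that [n] is drawn. Comparing the
     two products isolates the factor [B / N]. *)
  pose E t := if insub t is Some i then [set h i]
              else [set A : {set 'I_N} | n \in A].
  have Eh (i : 'I_k) : E i = [set h i] by rewrite /E valK.
  have Ek : E k = [set A : {set 'I_N} | n \in A] by rewrite /E insubF // ltnn.
  have := @idraw (iota 0 k) E (iota_uniq _ _).
  have := @idraw (k :: iota 0 k) E.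
  rewrite big_cons -(history_preimage draw Eh) /= mem_iota /= add0n ltnn.
  rewrite iota_uniq => /(_ isT).
  have -> : \bigcap_(t in [set` k :: iota 0 k]) (draw t @^-1` E t) =
      draw k @^-1` E k `&` \bigcap_(t in [set` iota 0 k]) (draw t @^-1` E t).
    apply/seteqP; split => w.
      move=> H; split=> [|t tk]; apply: H; rewrite /= inE ?eqxx //.
      by rewrite (tk : t \in _) orbT.
    by move=> [Hk H] t /=; rewrite inE => /predU1P[->//|]; exact: H.
  rewrite -(history_preimage draw Eh) Ek => Hk Hh.
  by rewrite setIC Hk -Hh (prob_draw_in k n BN mdraw udraw) muleC.
rewrite -(fineK (fP _ (mH h))) -!EFinM; congr (_%:E); ring.
Qed.

(** * Runs of the algorithm *)

Lemma submxrow_comb (R : realType) (N : nat) (d : 'I_N -> nat) (a b : R)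
    (u v : 'rV[R]_(\sum_(n < N) d n)) (n : 'I_N) :
  submxrow (a *: u + b *: v) n = a *: submxrow u n + b *: submxrow v n.
Proof. by apply/matrixP => i j; rewrite !mxE. Qed.

Lemma submxrow_inj (R : realType) (N : nat) (d : 'I_N -> nat)
    (u v : 'rV[R]_(\sum_(n < N) d n)) :
  (forall n, submxrow u n = submxrow v n) -> u = v.
Proof.
by move=> uv; rewrite -(submxrowK u) -(submxrowK v); exact: eq_mxrow.
Qed.

(** The index shift matters: the minimizers of step [k] may depend on draw [k], but they enter only
    [x k.+1]. Hence [x k] is settled before draw [k], as independence requires. *)
Lemma rbfw_run_adapted (R : realType) (N : nat) (d : 'I_N -> nat)
    (X : forall n : 'I_N, set 'rV[R]_(d n)) (f : 'rV[R]_(\sum_(n < N) d n) -> R)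
    (gamma : nat -> R) (x0 : 'rV[R]_(\sum_(n < N) d n)) (T : Type)
    (draw : nat -> T -> {set 'I_N})
    (s : nat -> T -> forall n : 'I_N, 'rV[R]_(d n))
    (x : nat -> T -> 'rV[R]_(\sum_(n < N) d n)) :
  rbfw_run X f gamma x0 draw s x -> forall k, adapted draw k (x k).
Proof.
move=> run; elim=> [|k ih] w w' ww'; first by rewrite !(run_init run).
have e : draw k w = draw k w' by exact: ww'.
apply: submxrow_inj => n; rewrite !(run_update run) -e.
rewrite (ih w w'); last by move=> i ik; apply: ww'; exact: ltnW.
case: ifP => // nk.
by rewrite (run_adapted run (w' := w')) // => i ik; apply: ww'.
Qed.

Lemma rbfw_run_feasible (R : realType) (N : nat) (d : 'I_N -> nat)
    (X : forall n : 'I_N, set 'rV[R]_(d n)) (f : 'rV[R]_(\sum_(n < N) d n) -> R)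
    (gamma : nat -> R) (x0 : 'rV[R]_(\sum_(n < N) d n)) (T : Type)
    (draw : nat -> T -> {set 'I_N})
    (s : nat -> T -> forall n : 'I_N, 'rV[R]_(d n))
    (x : nat -> T -> 'rV[R]_(\sum_(n < N) d n)) :
  (forall n, convex_set (X n)) -> (forall t, 0 <= gamma t <= 1) ->
  feasible X x0 -> rbfw_run X f gamma x0 draw s x ->
  forall k w, feasible X (x k w).
Proof.
move=> cX g01 Xx0 run; elim=> [|k ih] w n; first by rewrite (run_init run).
rewrite (run_update run); case: ifP => nk; last exact: ih.
apply: convex_set_comb => //; first exact: ih.
by have [] := run_argmin run nk.
Qed.

Lemma rbfw_run_descent (R : realType) (N : nat) (d : 'I_N -> nat)
    (X : forall n : 'I_N, set 'rV[R]_(d n)) (f : 'rV[R]_(\sum_(n < N) d n) -> R)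
    (gamma : nat -> R) (x0 : 'rV[R]_(\sum_(n < N) d n)) (T : Type)
    (draw : nat -> T -> {set 'I_N})
    (s : nat -> T -> forall n : 'I_N, 'rV[R]_(d n))
    (x : nat -> T -> 'rV[R]_(\sum_(n < N) d n)) (k : nat) (w : T) :
  curvature_constant (feasible X) f \is a fin_num -> 0 < gamma k <= 1 ->
  rbfw_run X f gamma x0 draw s x -> feasible X (x k w) ->
  f (x k.+1 w) <= f (x k w)
    - gamma k * \sum_n (n \in draw k w)%:R * block_gap X f (x k w) n
    + gamma k ^+ 2 / 2 * fine (curvature_constant (feasible X) f).
Proof.
move=> fC g01 run Xx.
(* Keeping the undrawn blocks of [x k w] in the target makes the convex combination leave them
   unchanged, so a partial update is an ordinary full step towards [v]. *)
pose v := \mxrow_n (if n \in draw k w then s k w n else submxrow (x k w) n).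
have Xv : feasible X v.
  move=> n; rewrite mxrowK; case: ifP => nk; last exact: Xx.
  by have [] := run_argmin run nk.
have -> : x k.+1 w = (1 - gamma k) *: x k w + gamma k *: v.
  apply: submxrow_inj => n; rewrite (run_update run) submxrow_comb mxrowK.
  by case: ifP => // _; rewrite -scalerDl subrK scale1r.
apply: le_trans (curvature_bound fC g01 Xx Xv) _.
rewrite lerD2r lerD2l -mulrN -sumrN dot_submxrow.
have -> // : \sum_n dot (submxrow (v - x k w) n) (submxrow (grad f (x k w)) n) =
  \sum_n - ((n \in draw k w)%:R * block_gap X f (x k w) n).
apply: eq_bigr => n _; rewrite submxrowB mxrowK; case: ifP => nk.
  by rewrite mul1r (block_gap_argmin (run_argmin run nk)) !dotBl opprB.
by rewrite subrr dot0l mul0r oppr0.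
Qed.

(** Every block gap is adapted at [k], so averaging over draw [k] multiplies each by the same factor
    [B / N], and the sum over blocks restores the full duality gap. *)
Lemma rbfw_run_mean_descent (R : realType) (N B : nat) (d : 'I_N -> nat)
    (X : forall n : 'I_N, set 'rV[R]_(d n)) (f : 'rV[R]_(\sum_(n < N) d n) -> R)
    (gamma : nat -> R) (x0 : 'rV[R]_(\sum_(n < N) d n))
    (disp : measure_display) (T : measurableType disp) (P : probability T R)
    (draw : nat -> T -> {set 'I_N})
    (s : nat -> T -> forall n : 'I_N, 'rV[R]_(d n))
    (x : nat -> T -> 'rV[R]_(\sum_(n < N) d n)) (k : nat) :
  (B <= N)%N -> (forall n, X n !=set0) -> (forall n, compact (X n)) ->
  curvature_constant (feasible X) f \is a fin_num -> 0 < gamma k <= 1 ->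
  (forall w, feasible X (x k w)) -> measurable_draws draw ->
  uniform_draws B P draw -> independent_draws P draw ->
  rbfw_run X f gamma x0 draw s x ->
  fine 'E_P[fun w => f (x k.+1 w)]%E <= fine 'E_P[fun w => f (x k w)]%E
    - gamma k * (B%:R / N%:R *
        fine 'E_P[fun w => duality_gap (feasible X) f (x k w)]%E)
    + gamma k ^+ 2 / 2 * fine (curvature_constant (feasible X) f).
Proof.
move=> BN X0 cX fC g01 Xx mdraw udraw idraw run.
have ax := rbfw_run_adapted run.
pose Z n w := (n \in draw k w)%:R * block_gap X f (x k w) n.
have LF i : (fun w => f (x i w)) \in Lfun P 1.
  by apply: (adapted_Lfun P mdraw (k := i)) => w w' /ax ->.
have ag n : adapted draw k (fun w => block_gap X f (x k w) n).
  by move=> w w' /ax ->.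
have Lg n : (fun w => block_gap X f (x k w) n) \in Lfun P 1.
  exact: (adapted_Lfun P mdraw (ag n)).
(* [Z n] also looks at draw [k], hence it is adapted only at [k.+1]. *)
have LZ n : Z n \in Lfun P 1.
  apply: (adapted_Lfun P mdraw (k := k.+1)) => w w' ww'.
  by rewrite /Z ww' // (ag n w w') // => i ik; apply: ww'; exact: ltnW.
set C := fine (curvature_constant _ _).
have EZ : 'E_P[\sum_n Z n]%E =
    (B%:R / N%:R * fine 'E_P[fun w => duality_gap (feasible X) f (x k w)]%E)%:E.
  have -> : (fun w => duality_gap (feasible X) f (x k w)) =
      \sum_n (fun w => block_gap X f (x k w) n).
    by apply/funext => w; rewrite duality_gapE // fct_sumE.
  have Esum (F : 'I_N -> T -> R) : (forall n, F n \in Lfun P 1) ->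
      'E_P[\sum_n F n]%E = (\sum_n 'E_P[F n])%E.
    move=> LFn; rewrite -(big_map F xpredT id) expectation_sum ?big_map //.
    by move=> Y /mapP[n _ ->].
  rewrite !Esum // EFinM fineK; last first.
    by apply/sum_fin_numP => n _ _; exact: expectation_fin_num.
  under eq_bigr => n _ do
    rewrite (expectation_adapted_draw n BN mdraw udraw idraw (ag n)).
  rewrite -(eq_bigr _ (fun n _ => fineK (expectation_fin_num (Lg n)))).
  under eq_bigr => n _ do rewrite -(fineK (expectation_fin_num (Lg n))) -EFinM.
  by rewrite !sumEFin -EFinM mulr_sumr.
have LS : \sum_n Z n \in Lfun P 1.
  by apply: rpred_sum => n _; exact: LZ.
have LgS : gamma k \o* (\sum_n Z n) \in Lfun P 1.
  by apply: Lfun_scale.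
pose c : T -> R := cst (gamma k ^+ 2 / 2 * C).
have Lc : c \in Lfun P 1 by exact: Lfun_cst.
have LB : (fun w => f (x k w)) \- gamma k \o* (\sum_n Z n) \in Lfun P 1.
  exact: rpredB.
have le1 : ('E_P[fun w => f (x k.+1 w)] <=
   'E_P[(((fun w => f (x k w)) \- (gamma k \o* (\sum_n Z n))) \+ c)%R])%E.
  apply: expectation_le_Lfun => //; first exact: rpredD.
  move=> w /=; rewrite fct_sumE mulrC.
  exact: rbfw_run_descent run (Xx w).
move: le1; rewrite expectationD // expectationB // expectationZl // EZ.
rewrite expectation_cst -(fineK (expectation_fin_num (LF k.+1))).
by rewrite -(fineK (expectation_fin_num (LF k))) -EFinM -EFinB -EFinD lee_fin.
Qed.

(** Supplies the real number [b] required by [descent_rate] from a minimum taken in the extended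
    reals. *)
Lemma best_expected_gapP (R : realType) (m : nat) (A : set 'rV[R]_m)
    (f : 'rV[R]_m -> R) (disp : measure_display) (T : measurableType disp)
    (P : probability T R) (x : nat -> T -> 'rV[R]_m) (t : nat)
    (G := fun k => 'E_P[fun w => duality_gap A f (x k w)]%E) :
  (forall k, G k \is a fin_num) -> (forall k, 0 <= G k)%E ->
  0 <= fine (best_expected_gap A f P x t) /\
  forall k, (k <= t)%N -> fine (best_expected_gap A f P x t) <= fine (G k).
Proof.
move=> Gfin G0.
have b0 : (0 <= best_expected_gap A f P x t)%E.
  by apply: le_bigmin => [|k _]; [exact: leey|exact: G0].
have bG k : (k <= t)%N -> (best_expected_gap A f P x t <= G k)%E.
  move=> kt; exact: (@bigmin_le _ _ _ _ (Ordinal (kt : (k < t.+1)%N))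
    (fun i : 'I_t.+1 => G i)).
split=> [|k kt]; first exact: fine_ge0.
apply: fine_le => //; last exact: bG.
(* Finiteness has to be checked because [fine] sends infinite values to 0 and is monotone only on
   finite ones. *)
rewrite ge0_fin_numE //; apply: le_lt_trans (bG _ kt) _.
by rewrite ltey_eq Gfin.
Qed.
Theorem mainTheorem7 (R : realType) (N B : nat) (d : 'I_N -> nat)
    (X : forall n : 'I_N, set 'rV[R]_(d n))
    (U : set 'rV[R]_(\sum_(n < N) d n))
    (f : 'rV[R]_(\sum_(n < N) d n) -> R)
    (disp : measure_display) (T : measurableType disp) (P : probability T R)
    (draw : nat -> T -> {set 'I_N})
    (x0 : 'rV[R]_(\sum_(n < N) d n))
    (s : nat -> T -> forall n : 'I_N, 'rV[R]_(d n))
    (x : nat -> T -> 'rV[R]_(\sum_(n < N) d n))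
    (alpha := B%:R / N%:R : R)
    (gamma := fun t : nat => 2 / (alpha * t%:R + 2) : R) :
  (1 <= N)%N ->
  (1 <= B <= N)%N ->
  (forall n, X n !=set0) ->
  (forall n, convex_set (X n)) ->
  (forall n, compact (X n)) ->
  open U -> feasible X `<=` U ->
  (forall y, U y -> differentiable f y) ->
  curvature_constant (feasible X) f \is a fin_num ->
  feasible X x0 ->
  measurable_draws draw ->
  uniform_draws B P draw ->
  independent_draws P draw ->
  rbfw_run X f gamma x0 draw s x ->
  (forall k, 'E_P[fun w => duality_gap (feasible X) f (x k w)]%E \is a fin_num)
  /\ (fun t : nat => fine (best_expected_gap (feasible X) f P x t)) =O_\oo
     (fun t : nat => (ln (t%:R : R))^-1).
Proof.
move=> N1 /andP[B1 BN] X0 vX cX oU XU fU fC Xx0 mdraw udraw idraw run.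
have a01 : 0 < alpha <= 1.
  rewrite divr_gt0 ?ltr0n //= ler_pdivrMr ?ltr0n // mul1r ler_nat //.
have g01 k : 0 < gamma k <= 1 by have [] := step_bounds k a01.
have Xx : forall k w, feasible X (x k w).
  apply: rbfw_run_feasible Xx0 run => // k.
  by have /andP[/ltW -> ->] := g01 k.
set G := fun k => 'E_P[fun w => duality_gap (feasible X) f (x k w)]%E.
have Gfin k : G k \is a fin_num.
  apply: expectation_fin_num; apply: (adapted_Lfun P mdraw (k := k)) => w w'.
  by move=> /(rbfw_run_adapted run) ->.
split=> //.
have G0 k : (0 <= G k)%E.
  apply: expectation_ge0 => w; rewrite duality_gapE //.
  apply: sumr_ge0 => n _; rewrite /block_gap dotBl subr_ge0.
  by apply: (block_minP f (x k w) (X0 n) (cX n)).2; exact: Xx.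
have feas0 : feasible X !=set0 by exists x0.
have C0 := curvature_ge0 feas0 fC.
(* The extreme value theorem provides the lower bound [f z] that stops the telescoped descent;
   continuity on the feasible set comes from differentiability on [U]. *)
have [z Xz fz] : exists2 z, z \in feasible X &
    forall y, y \in feasible X -> f z <= f y.
  apply: EVT_min_rV feas0 (compact_feasible cX) _.
  apply: continuous_in_subspaceT => y /set_mem /XU Uy.
  exact: differentiable_continuous (fU _ Uy).
pose F k := fine 'E_P[fun w => f (x k w)]%E.
have mF k : f z <= F k.
  have LF : (fun w => f (x k w)) \in Lfun P 1.
    apply: (adapted_Lfun P mdraw (k := k)) => w w'.
    by move=> /(rbfw_run_adapted run) ->.
  rewrite -lee_fin fineK ?expectation_fin_num // -(expectation_cst P (f z)).
  apply: expectation_le_Lfun => //; first exact: Lfun_cst.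
  by move=> w; apply: fz; apply/mem_set.
have step k := rbfw_run_mean_descent BN X0 cX fC (g01 k) (Xx k)
  mdraw udraw idraw run.
set K := F 0%N - f z +
  4 / alpha ^+ 2 * fine (curvature_constant (feasible X) f).
have /andP[a0 _] := a01.
have rate t :
    alpha * fine (best_expected_gap (feasible X) f P x t) * ln t%:R <= K.
  have [b0 bG] := best_expected_gapP t Gfin G0.
  exact: (descent_rate a01 C0 mF step b0 bG).
(* [K] does not depend on [t], so any [M] above [K / alpha] works; taking [t > 1] makes [ln t]
   positive and its inverse meaningful. *)
apply/eqOP; near=> M; near=> t.
have [b0 _] := best_expected_gapP t Gfin G0.
have l0 : 0 < ln (t%:R : R).
  apply: ln_gt0; rewrite (_ : 1 = 1%:R) // ltr_nat.
  by near: t; exact: nbhs_infty_gt.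
rewrite (ger0_norm b0) ger0_norm; last by rewrite invr_ge0 ltW.
rewrite ler_pdivlMr //.
apply: le_trans (_ : K / alpha <= _); last first.
  by near: M; exact: nbhs_pinfty_ge (num_real _).
by rewrite ler_pdivlMr // mulrC mulrA.
Unshelve. all: by end_near. Qed.
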